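(* Let $\varepsilon\in(0,1/100)$, $\boldsymbol{u}=(5/6,1/6)$ and $\boldsymbol{v}=(7/8,1/8)$. For any nonnegative $2\times2$ matrix $A$ that is $(\boldsymbol{u},\boldsymbol{v})$-scalable, let $A^{(0)},A^{(1)},\dots$ be the SK iterates with input $(A,(\boldsymbol{u},\boldsymbol{v}))$ and let $K$ be the least $k$ with $\|\boldsymbol{r}(A^{(k)})-\boldsymbol{u}\|_1+\|\boldsymbol{c}(A^{(k)})-\boldsymbol{v}\|_1\le\varepsilon$. Then $K=O(-\log\nu(A)-\log\varepsilon)$.
   Context: SK on input $(A,(\boldsymbol{u},\boldsymbol{v}))$: $A^{(0)}_{ij}=u_iA_{ij}/r_i(A)$; odd $k$: $A^{(k)}_{ij}=v_jA^{(k-1)}_{ij}/c_j(A^{(k-1)})$; even $k\ge2$: $A^{(k)}_{ij}=u_iA^{(k-1)}_{ij}/r_i(A^{(k-1)})$ ($r_i,c_j$ row/column sums). $A$ is $(\boldsymbol{u},\boldsymbol{v})$-scalable if there exist positive diagonal $X,Y$ with $XAY$ having row sums $\boldsymbol{u}$ and column sums $\boldsymbol{v}$. $\nu(A)=\frac{\min_{A_{ij}>0}A_{ij}/r_i(A)}{\max_{i,j}A_{ij}/r_i(A)}$. $O$ hides an absolute constant. *)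

(* Defs.v *)
From HB Require Import structures.
From mathcomp Require Import all_boot all_order all_algebra.
From mathcomp Require Import reals exp.
Set Implicit Arguments.
Unset Strict Implicit.
Unset Printing Implicit Defensive.
Import Order.TTheory GRing.Theory Num.Theory.
Local Open Scope ring_scope.

Section Sinkhorn.
Variables (R : realType) (m n : nat).
Implicit Types (A : 'M[R]_(m, n)) (u : 'rV[R]_m) (v : 'rV[R]_n).

Definition nonneg_mx A : Prop := forall i j, 0 <= A i j.

Definition row_sums A : 'rV[R]_m := \row_i \sum_j A i j.
Definition col_sums A : 'rV[R]_n := \row_j \sum_i A i j.

Definition row_scale u A : 'M[R]_(m, n) :=
  \matrix_(i, j) (u 0 i * A i j / row_sums A 0 i).
Definition col_scale v A : 'M[R]_(m, n) :=
  \matrix_(i, j) (v 0 j * A i j / col_sums A 0 j).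

Fixpoint sk u v A (k : nat) : 'M[R]_(m, n) :=
  if k is k'.+1 then
    if odd k'.+1 then col_scale v (sk u v A k') else row_scale u (sk u v A k')
  else row_scale u A.

Definition uv_scalable u v A : Prop :=
  exists (x : 'rV[R]_m) (y : 'rV[R]_n),
    [/\ forall i, 0 < x 0 i, forall j, 0 < y 0 j,
        row_sums (diag_mx x *m A *m diag_mx y) = u
      & col_sums (diag_mx x *m A *m diag_mx y) = v].

(* For a nonnegative A every ratio A i j / r_i(A) lies in [0, 1], so the
   default values 1 of the minimum and 0 of the maximum do not affect them
   (as long as A has a positive entry). *)
Definition nu A : R :=
  (\big[Num.min/1]_(p : 'I_m * 'I_n | 0 < A p.1 p.2)
      (A p.1 p.2 / row_sums A 0 p.1)) /
  (\big[Num.max/0]_(p : 'I_m * 'I_n) (A p.1 p.2 / row_sums A 0 p.1)).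

End Sinkhorn.

(* The norm `|_| on row vectors is the sup norm, hence a separate l^1 norm. *)
Definition norm1 (R : realType) (n : nat) (x : 'rV[R]_n) : R :=
  \sum_j `|x 0 j|.

Definition sk_error (R : realType) (m n : nat) (u : 'rV[R]_m) (v : 'rV[R]_n)
    (B : 'M[R]_(m, n)) : R :=
  norm1 (row_sums B - u) + norm1 (col_sums B - v).

Definition is_least (P : nat -> Prop) (K : nat) : Prop :=
  P K /\ forall k, P k -> (K <= k)%N.

Definition u0 (R : realType) : 'rV[R]_2 := \row_i [:: 5 / 6; 1 / 6]`_i.
Definition v0 (R : realType) : 'rV[R]_2 := \row_j [:: 7 / 8; 1 / 8]`_j.

(* Main.v *)
Require Import Defs.
From HB Require Import structures.
From mathcomp Require Import all_boot all_order all_algebra.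
From mathcomp Require Import boolp reals exp.
From mathcomp Require Import ring lra.
Import Order.TTheory GRing.Theory Num.Theory.
Local Open Scope ring_scope.

(* Every even iterate has row sums [u0], so it is given by the pair [p] of the
   fractions that its two rows put in the first column; the error is then
   [2 |f - 7/8|], where [f] is the first column sum. One column and one row
   scaling multiply the odds [(1 - x) / x] of both fractions by the same number
   [f / (7 (1 - f))], and by convexity they keep [f] on the same side of [7/8].
   When [6/7 <= f <= 14/15], the distance [|f - 7/8|] shrinks by a constant
   factor: the plateaus [5/6] and [1/6], where [f] hardly reacts to the odds,
   are outside this band. When [f] is outside the band, the odds move
   geometrically, and since they start between [nu] and [1/nu] (or at 0), this
   lasts for [O(- ln nu)] steps. *)

(** * Dynamics of the two row fractions *)

Section Dynamics.
Variable R : realFieldType.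
Implicit Types (x rho : R) (p : R * R).

Definition odds x : R := (1 - x) / x.
Definition tilt rho x : R := x / (x + rho * (1 - x)).
Definition col1 p : R := 5 / 6 * p.1 + 1 / 6 * p.2.
(** Column scaling multiplies the columns by [(7 / 8) / col1 p] and [(1 / 8) / (1 - col1 p)]; this
    is the second factor divided by the first. *)
Definition ratio p : R := col1 p / (7 * (1 - col1 p)).
Definition sk_step p : R * R := (tilt (ratio p) p.1, tilt (ratio p) p.2).
Definition admissible p : Prop :=
  [/\ 0 < p.1 <= 1, 0 < p.2 <= 1 & col1 p < 1].
(** At the endpoints [ratio] equals 6/7 and 2, so outside the band it stays away from 1. *)
Definition in_band p : Prop := 6 / 7 <= col1 p <= 14 / 15.

Lemma tilt_den_gt0 rho x : 0 < rho -> 0 < x <= 1 -> 0 < x + rho * (1 - x).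
Proof. by move=> r0 /andP[x0 x1]; rewrite ltr_pwDl// mulr_ge0 ?subr_ge0 // ltW. Qed.

Lemma tilt_bounds rho x : 0 < rho -> 0 < x <= 1 -> 0 < tilt rho x <= 1.
Proof.
move=> r0 xb; have D0 := tilt_den_gt0 _ _ r0 xb; move/andP: (xb) => [x0 x1].
by rewrite /tilt divr_gt0//= ler_pdivrMr// mul1r lerDl mulr_ge0 ?subr_ge0 // ltW.
Qed.

Lemma odds_tilt rho x : 0 < rho -> 0 < x <= 1 ->
  odds (tilt rho x) = rho * odds x.
Proof.
move=> r0 xb; have D0 := tilt_den_gt0 _ _ r0 xb; move/andP: (xb) => [x0 x1].
by rewrite /odds /tilt; field; rewrite !gt_eqF.
Qed.

Lemma odds_ge0 x : 0 < x <= 1 -> 0 <= odds x.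
Proof. by move=> /andP[x0 x1]; rewrite divr_ge0 ?subr_ge0// ltW. Qed.

Lemma ratio_gt0 p : admissible p -> 0 < ratio p.
Proof.
move=> [/andP[x0 _] /andP[y0 _] f1].
by rewrite /ratio divr_gt0//; [rewrite /col1|]; lra.
Qed.

(** Only [col1 < 1] needs an argument: [col1 = 1] forces both fractions to be 1, and [tilt] takes
    the value 1 only at 1. *)
Lemma admissible_step p : admissible p -> admissible (sk_step p).
Proof.
move=> ap; have r0 := ratio_gt0 _ ap; case: ap => xb yb f1.
have /andP[x'0 x'1] := tilt_bounds _ _ r0 xb.
have /andP[y'0 y'1] := tilt_bounds _ _ r0 yb.
split; rewrite /sk_step/= ?x'0 ?y'0//.
rewrite ltNge; apply/negP => f'1.
have eq1 w : 0 < w <= 1 -> tilt (ratio p) w = 1 -> w = 1.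
  move=> wb; have D0 := tilt_den_gt0 _ _ r0 wb.
  rewrite /tilt => /divr1_eq /eqP; rewrite -subr_eq0 opprD addNKr oppr_eq0.
  by rewrite mulf_eq0 gt_eqF//= subr_eq0 => /eqP.
move: f'1; rewrite /col1/= => f'1.
have x1 := eq1 _ xb ltac:(lra); have y1 := eq1 _ yb ltac:(lra).
by move: f1; rewrite /col1 x1 y1; lra.
Qed.

(* The first identity measures the decrease of [col1 p], which gives [1 - Q <= 1];
   the second one is the Jensen gap of [tilt (ratio p)] (as
   [tilt (ratio p) (col1 p) = 7 / 8]), which gives [0 <= 1 - Q]. *)
Lemma col1_step p : admissible p ->
  let D w := w + ratio p * (1 - w) in
  let Q := 8 / (7 * (1 - col1 p)) *
    (5 / 6 * (p.1 * (1 - p.1) / D p.1) + 1 / 6 * (p.2 * (1 - p.2) / D p.2)) in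
  col1 (sk_step p) - 7 / 8 = (1 - Q) * (col1 p - 7 / 8) /\
  1 - Q = 5 / 36 * (p.1 - p.2) ^+ 2 /
    (7 * (1 - col1 p) ^+ 2 * (D p.1 * D p.2)).
Proof.
move=> ap; have r0 := ratio_gt0 _ ap; case: (ap) => xb yb f1.
have D1 := tilt_den_gt0 _ _ r0 xb; have D2 := tilt_den_gt0 _ _ r0 yb.
case: p {ap} xb yb f1 r0 D1 D2 => x y /= /andP[x0 x1] /andP[y0 y1] f1 r0 D1 D2.
move: f1 r0 D1 D2; rewrite /sk_step /tilt /ratio /col1/= => f1 r0 D1 D2.
have F1 : 1 - (5 / 6 * x + 1 / 6 * y) != 0 by rewrite gt_eqF//; lra.
have F0 : 5 / 6 * x + 1 / 6 * y != 0 by rewrite gt_eqF//; lra.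

(* Up to positive factors, [E1], [E2], [E3] are [D p.2], [D p.1] and [1 - col1 p] with fractions
   cleared, the form that [field] asks for. *)
have E1 : 0 < y * (7 * (6 - (5 * x + y))) + (5 * x + y) * (1 - y).
  by rewrite ltr_pwDl// ?mulr_gt0 ?mulr_ge0//; lra.
have E2 : 0 < x * (7 * (6 - (5 * x + y))) + (5 * x + y) * (1 - x).
  by rewrite ltr_pwDl// ?mulr_gt0 ?mulr_ge0//; lra.
have E3 : 0 < 6 - (5 * x + y) by lra.
by split; field; rewrite !gt_eqF.
Qed.

Lemma in_band_ratio p : in_band p -> ratio p <= 2.
Proof.
move=> /andP[f_ge f_le]; rewrite /ratio ler_pdivrMr; lra.
Qed.

(** The fractions cannot both be close to 0 or 1. The lower edge of the band forces [p.1 >= 29/35];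
    if moreover [p.1 > 99/100], the two edges force [1/7 <= p.2 <= 65/100]. *)
Lemma in_band_variance p : admissible p -> in_band p ->
  1 / 200 <= 5 / 6 * (p.1 * (1 - p.1)) + 1 / 6 * (p.2 * (1 - p.2)).
Proof.
case: p => x y [/= /andP[x0 x1] /andP[y0 y1] _].
rewrite /in_band /col1/= => /andP[f_ge f_le].
have V1 : 0 <= x * (1 - x) by rewrite mulr_ge0 ?subr_ge0 // ltW.
have V2 : 0 <= y * (1 - y) by rewrite mulr_ge0 ?subr_ge0 // ltW.
have [xle|xgt] := leP x (99 / 100).
- have : (29 / 35) * (1 / 100) <= x * (1 - x) by apply: ler_pM; lra.
  lra.
- have : (1 / 7) * (35 / 100) <= y * (1 - y) by apply: ler_pM; lra.
  lra.
Qed.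

(** Take [P = 1 - Q]. In the band, [ratio p <= 2] keeps both denominators in [Q] at most 2, so [Q]
    is at least half of the variance bound 1/200. *)
Lemma col1_step_contract p : admissible p ->
  exists P, [/\ 0 <= P <= 1,
    col1 (sk_step p) - 7 / 8 = P * (col1 p - 7 / 8)
    & in_band p -> P <= 399 / 400].
Proof.
move=> ap; have := col1_step _ ap; have r0 := ratio_gt0 _ ap.
cbv zeta; set Q := 8 / _ * _; move=> [eqP PE].
case: (ap) => xb yb f1.
have D1 := tilt_den_gt0 _ _ r0 xb; have D2 := tilt_den_gt0 _ _ r0 yb.
have /andP[x0 x1] := xb; have /andP[y0 y1] := yb.
exists (1 - Q); split=> //.
- apply/andP; split.
    rewrite PE; apply: divr_ge0; first by rewrite mulr_ge0 ?sqr_ge0//; lra.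
    by rewrite !mulr_ge0 ?sqr_ge0 ?(ltW D1) ?(ltW D2)//; lra.
  have V1 : 0 <= p.1 * (1 - p.1) / (p.1 + ratio p * (1 - p.1)).
    by rewrite divr_ge0 ?mulr_ge0 ?(ltW D1)//; lra.
  have V2 : 0 <= p.2 * (1 - p.2) / (p.2 + ratio p * (1 - p.2)).
    by rewrite divr_ge0 ?mulr_ge0 ?(ltW D2)//; lra.
  have V0 : 0 <= 8 / (7 * (1 - col1 p)) by rewrite divr_ge0//; lra.
  by rewrite gerBl /Q mulr_ge0//; lra.
- move=> bp; have r2 := in_band_ratio _ bp.
  have V := in_band_variance _ ap bp.
  have half w : 0 < w <= 1 -> w * (1 - w) / 2 <=
      w * (1 - w) / (w + ratio p * (1 - w)).
    move=> wb; have /andP[w0 w1] := wb.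
    rewrite ler_wpM2l ?mulr_ge0 ?subr_ge0 ?(ltW w0)//.
    rewrite lef_pV2 ?posrE ?(tilt_den_gt0 _ _ r0 wb)//; nra.
  have H1 := half _ xb; have H2 := half _ yb.
  have c1 : 1 <= 8 / (7 * (1 - col1 p)).
    have ? : 0 < col1 p by move: bp; rewrite /in_band; lra.
    by rewrite ler_pdivlMr; lra.
  rewrite lerBlDl -lerBlDr.
  apply: (@le_trans _ _ (1 * (1 / 400))); first lra.
  apply: ler_pM => //; lra.
Qed.

(** A factor in [0, 1] moves [col1] towards 7/8, a point of the band, without crossing it. *)
Lemma in_band_step p : admissible p -> in_band p -> in_band (sk_step p).
Proof.
move=> /col1_step_contract[P [/andP[P0 P1] eqP _]].
rewrite /in_band => /andP[f_ge f_le].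
have [le|ge] := leP (col1 p) (7 / 8); apply/andP; split; nra.
Qed.

Lemma admissible_iter n p : admissible p -> admissible (iter n sk_step p).
Proof. by move=> ap; elim: n => //= n; apply: admissible_step. Qed.

Lemma col1_iter_ge n p : admissible p -> 7 / 8 <= col1 p ->
  7 / 8 <= col1 (iter n sk_step p).
Proof.
move=> ap ge; elim: n => //= n IH.
have [P [/andP[P0 _] eqP _]] := col1_step_contract _ (admissible_iter n _ ap).
by rewrite -subr_ge0 eqP mulr_ge0// subr_ge0.
Qed.

Lemma col1_iter_le n p : admissible p -> col1 p <= 7 / 8 ->
  col1 (iter n sk_step p) <= 7 / 8.
Proof.
move=> ap le; elim: n => //= n IH.
have [P [/andP[P0 _] eqP _]] := col1_step_contract _ (admissible_iter n _ ap).
by rewrite -subr_le0 eqP mulr_ge0_le0// subr_le0.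
Qed.

(** One rate for both phases: [rate * (399 / 400) <= 1] in the band, and outside it [ratio] is at
    least [rate] or at most [rate^-1]. *)
Definition rate : R := 401 / 400.

Lemma in_band_iter n p : admissible p -> in_band p ->
  rate ^+ n * `|col1 (iter n sk_step p) - 7 / 8| <= `|col1 p - 7 / 8|.
Proof.
move=> ap bp.
suff: in_band (iter n sk_step p) /\
  rate ^+ n * `|col1 (iter n sk_step p) - 7 / 8| <= `|col1 p - 7 / 8|.
  by case.
elim: n => [|n [bn IH]]; first by rewrite expr0 mul1r.
have an := admissible_iter n _ ap; rewrite iterS.
split; first exact: in_band_step.
have [P [/andP[P0 P1] -> /(_ bn) Ple]] := col1_step_contract _ an.
apply: le_trans IH; rewrite exprSr normrM (ger0_norm P0) -mulrA.
apply: ler_wpM2l; first by rewrite exprn_ge0// /rate; lra.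
rewrite mulrA -[leRHS]mul1r ler_wpM2r// /rate; lra.
Qed.

Lemma odds_iter n p : admissible p ->
  (odds (iter n sk_step p).1 = (\prod_(j < n) ratio (iter j sk_step p)) * odds p.1) *
  (odds (iter n sk_step p).2 = (\prod_(j < n) ratio (iter j sk_step p)) * odds p.2).
Proof.
move=> ap; elim: n => [|n IH]; first by rewrite big_ord0 !mul1r.
have an := admissible_iter n _ ap; have r0 := ratio_gt0 _ an; case: an => xb yb _.
rewrite iterS big_ord_recr/= !odds_tilt// !IH.
by split; rewrite mulrCA mulrA.
Qed.

(* Outside the band all ratios are bounded away from [1] on the same side, so
   the odds move geometrically. *)
Lemma band_entry_time nu n p : admissible p -> 0 < nu ->
  (forall w, w = p.1 \/ w = p.2 ->
     (w < 1 -> nu <= odds w) /\ nu * odds w <= 1) ->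
  (forall j, (j <= n)%N -> ~ in_band (iter j sk_step p)) ->
  nu * rate ^+ n <= 6.
Proof.
move=> ap nu0 nuP nband; have an := admissible_iter n _ ap.
have rate0 : 0 <= rate by rewrite /rate; lra.
have [_ _ f1] := ap; have [xb yb _] := an.
have [ge|/ltW le] := leP (7 / 8) (col1 p).
- have big j : (j <= n)%N -> 14 / 15 < col1 (iter j sk_step p).
    move=> /nband nb; rewrite ltNge; apply/negP => fle; apply: nb.
    by apply/andP; split=> //; have := col1_iter_ge j _ ap ge; lra.
  have prod_ge : rate ^+ n <= \prod_(j < n) ratio (iter j sk_step p).
    rewrite -[X in _ ^+ X]card_ord -prodr_const; apply: ler_prod => j _.
    rewrite rate0/=; have fj := big j (ltnW (ltn_ord j)).
    have [_ _ fj1] := admissible_iter j _ ap.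
    by rewrite /rate /ratio ler_pdivlMr; lra.
  have odds_lt1 w : 1 / 2 < w -> odds w <= 1.
    by move=> w2; rewrite /odds ler_pdivrMr; lra.
  have fn := big n (leqnn n); move: fn; rewrite /col1 => fn.
  have [/andP[_ x1] /andP[_ y1]] := (xb, yb).
  have o1 : odds (iter n sk_step p).1 <= 1 by apply: odds_lt1; lra.
  have o2 : odds (iter n sk_step p).2 <= 1 by apply: odds_lt1; lra.
  (* Since [col1 p < 1], some row starts with nonzero odds, hence at least [nu]. They grow by [rate]
     per step, yet end at most 1, because [col1 > 14/15] puts both final fractions above 1/2. *)
  suff [w [nuw oden]] : exists w, nu <= odds w /\ rate ^+ n * odds w <= 1.
    apply: le_trans (_ : 1 <= _); last by lra.
    by apply: le_trans oden; rewrite mulrC ler_wpM2l ?exprn_ge0.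
  have [xb0 yb0 _] := ap.
  have [p1|p1] := ltP p.1 1.
    exists p.1; split; first by apply: (nuP _ _).1 => //; left.
    by apply: le_trans o1; rewrite odds_iter// ler_wpM2r ?odds_ge0.
  exists p.2; split.
    by apply: (nuP _ _).1 => //; [right|move: f1; rewrite /col1; lra].
  by apply: le_trans o2; rewrite odds_iter// ler_wpM2r ?odds_ge0.
- have small j : (j <= n)%N -> col1 (iter j sk_step p) < 6 / 7.
    move=> /nband nb; rewrite ltNge; apply/negP => fle; apply: nb.
    by apply/andP; split=> //; have := col1_iter_le j _ ap le; lra.
  have prod_le : \prod_(j < n) ratio (iter j sk_step p) <= rate^-1 ^+ n.
    rewrite -[X in _ ^+ X]card_ord -prodr_const; apply: ler_prod => j _.
    have aj := admissible_iter j _ ap.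
    rewrite ltW ?ratio_gt0//=; have fj := small j (ltnW (ltn_ord j)).
    by rewrite /rate /ratio invf_div ler_pdivrMr; lra.
  have odds_ge w : 0 < w -> w <= 6 / 7 -> 1 / 6 <= odds w.
    by move=> w0 w6; rewrite /odds ler_pdivlMr; lra.
  have [xb0 yb0 _] := ap.
  (* Some final fraction is at most the mean [col1 < 6/7], so its odds are at least 1/6, although
     they started at most [1 / nu] and shrank by [rate] per step. This is the source of the 6 in the
     bound. *)
  suff [w [w1 [w0 ow]]] : exists w, nu * odds w <= 1 /\
      0 <= odds w /\ 1 / 6 <= rate^-1 ^+ n * odds w.
    have rn0 : 0 < rate ^+ n by rewrite exprn_gt0// /rate; lra.
    have : 1 / 6 * rate ^+ n <= odds w.
      by rewrite -ler_pdivlMr// [leRHS]mulrC -exprVn.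
    move=> H; have : nu * (1 / 6 * rate ^+ n) <= nu * odds w by rewrite ler_pM2l.
    lra.
  have fn := small n (leqnn n); move: fn; rewrite /col1 => fn.
  have [/andP[x0 x1] /andP[y0 y1]] := (xb, yb).
  have [p1|p1] := leP (iter n sk_step p).1 (6 / 7).
    exists p.1; split; first by apply: (nuP _ _).2 => //; left.
    split; first exact: odds_ge0.
    apply: le_trans (odds_ge _ x0 p1) _.
    by rewrite odds_iter// ler_wpM2r ?odds_ge0.
  exists p.2; split; first by apply: (nuP _ _).2 => //; right.
  split; first exact: odds_ge0.
  apply: le_trans (odds_ge _ y0 _) _; first lra.
  by rewrite odds_iter// ler_wpM2r ?odds_ge0.
Qed.

End Dynamics.

(** * Bounds on entry ratios by [nu] *)

Section Ratios.
Variables (R : realType) (m n : nat) (A : 'M[R]_(m, n)).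
Hypothesis A_ge0 : nonneg_mx A.

Lemma row_sums_gt0 i j : 0 < A i j -> 0 < row_sums A 0 i.
Proof.
by move=> Aij; rewrite mxE (bigD1 j)//= ltr_pwDl// sumr_ge0.
Qed.

Lemma max_ratio_gt0 i j : 0 < A i j ->
  0 < \big[Num.max/0]_(p : 'I_m * 'I_n) (A p.1 p.2 / row_sums A 0 p.1).
Proof.
move=> Aij; apply: lt_le_trans (le_bigmax 0 _ (i, j)).
by rewrite divr_gt0// (row_sums_gt0 _ j).
Qed.

Lemma nu_gt0 i j : 0 < A i j -> 0 < nu A.
Proof.
move=> Aij; apply: divr_gt0; last exact: max_ratio_gt0 Aij.
by apply: lt_bigmin => // p Ap; rewrite divr_gt0// (row_sums_gt0 _ p.2).
Qed.

(** After division by the common row sum, the entry at [j] is at least the minimum in [nu] and the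
    one at [k] at most the maximum. *)
Lemma nu_mul_le i j k : 0 < A i j -> nu A * A i k <= A i j.
Proof.
move=> Aij; have r0 := row_sums_gt0 _ _ Aij; have M0 := max_ratio_gt0 _ _ Aij.
have nu0 := nu_gt0 _ _ Aij.
rewrite -(@ler_pM2r _ (row_sums A 0 i)^-1) ?invr_gt0// -mulrA.
have := bigmin_le_cond (1 : R) (j := (i, j)) (P := fun p : 'I_m * 'I_n => 0 < A p.1 p.2)
  (fun p => A p.1 p.2 / row_sums A 0 p.1) Aij.
apply: le_trans.
have := le_bigmax 0 (fun p : 'I_m * 'I_n => A p.1 p.2 / row_sums A 0 p.1) (i, k).
by move/(ler_wpM2l (ltW nu0))/le_trans; apply; rewrite /nu divfK// gt_eqF.
Qed.

End Ratios.

(** * From matrices to pairs of fractions *)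

Section TwoByTwo.
Variable R : realType.
Implicit Types (A : 'M[R]_2) (p : R * R).

Lemma big_ord2 (F : 'I_2 -> R) : \sum_i F i = F 0 + F 1.
Proof. by rewrite big_ord_recl big_ord1; congr (_ + F _); apply: val_inj. Qed.

Lemma ord2_cases (i : 'I_2) : i = 0 \/ i = 1.
Proof. by case: i => [[|[|//]] ?]; [left|right]; apply: val_inj. Qed.

Lemma row_sums2 A i : row_sums A 0 i = A i 0 + A i 1.
Proof. by rewrite mxE big_ord2. Qed.

Lemma col_sums2 A j : col_sums A 0 j = A 0 j + A 1 j.
Proof. by rewrite mxE big_ord2. Qed.

Lemma norm1_2 (x : 'rV[R]_2) : norm1 x = `|x 0 0| + `|x 0 1|.
Proof. by rewrite /norm1 big_ord2. Qed.

Lemma u0E : (u0 R 0 0 = 5 / 6) * (u0 R 0 1 = 1 / 6).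
Proof. by rewrite !mxE. Qed.

Lemma v0E : (v0 R 0 0 = 7 / 8) * (v0 R 0 1 = 1 / 8).
Proof. by rewrite !mxE. Qed.

Definition split_mx p : 'M[R]_2 := \matrix_(i, j)
  let w := if i == 0 then p.1 else p.2 in
  u0 R 0 i * (if j == 0 then w else 1 - w).

Lemma split_mxE p : (split_mx p 0 0 = 5 / 6 * p.1) *
  (split_mx p 0 1 = 5 / 6 * (1 - p.1)) * (split_mx p 1 0 = 1 / 6 * p.2) *
  (split_mx p 1 1 = 1 / 6 * (1 - p.2)).
Proof. by rewrite ![split_mx _ _ _]mxE /= !u0E. Qed.

Lemma row_scaleE u A i j : row_scale u A i j = u 0 i * A i j / (A i 0 + A i 1).
Proof. by rewrite mxE row_sums2. Qed.

Lemma col_scaleE v A i j : col_scale v A i j = v 0 j * A i j / (A 0 j + A 1 j).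
Proof. by rewrite mxE col_sums2. Qed.

Lemma matrix2P A (B : 'M[R]_2) : A 0 0 = B 0 0 -> A 0 1 = B 0 1 -> A 1 0 = B 1 0 ->
  A 1 1 = B 1 1 -> A = B.
Proof.
by move=> *; apply/matrixP => i j; case: (ord2_cases i) (ord2_cases j) => -> [] ->.
Qed.

Lemma row_scale_split A : 0 < A 0 0 + A 0 1 -> 0 < A 1 0 + A 1 1 ->
  row_scale (u0 R) A =
  split_mx (A 0 0 / (A 0 0 + A 0 1), A 1 0 / (A 1 0 + A 1 1)).
Proof.
by move=> r0 r1; apply: matrix2P; rewrite row_scaleE split_mxE u0E/=;
  field; rewrite gt_eqF.
Qed.

Lemma double_scale_split p : admissible _ p ->
  row_scale (u0 R) (col_scale (v0 R) (split_mx p)) = split_mx (sk_step _ p).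
Proof.
move=> ap; have r0 := ratio_gt0 _ _ ap; case: (ap) => xb yb f1.
have D1 := tilt_den_gt0 _ _ _ r0 xb; have D2 := tilt_den_gt0 _ _ _ r0 yb.
case: p {ap} xb yb f1 r0 D1 D2 => x y /= /andP[x0 x1] /andP[y0 y1] f1 r0 D1 D2.
move: f1 r0 D1 D2; rewrite /sk_step /tilt /ratio /col1/= => f1 r0 D1 D2.
have E1 : 0 < y * (7 * (6 - (5 * x + y))) + (5 * x + y) * (1 - y).
  by rewrite ltr_pwDl// ?mulr_gt0 ?mulr_ge0//; lra.
have E2 : 0 < x * (7 * (6 - (5 * x + y))) + (5 * x + y) * (1 - x).
  by rewrite ltr_pwDl// ?mulr_gt0 ?mulr_ge0//; lra.
have E3 : 0 < 6 - (5 * x + y) by lra.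
have E4 : 0 < 5 * x + y by lra.
apply: matrix2P; rewrite row_scaleE !col_scaleE !split_mxE u0E !v0E/=; field;
  by rewrite !gt_eqF//; lra.
Qed.

Lemma sk_double A p n : admissible _ p -> row_scale (u0 R) A = split_mx p ->
  sk (u0 R) (v0 R) A n.*2 = split_mx (iter n (sk_step _) p).
Proof.
move=> ap A0; elim: n => [//|n IH].
rewrite doubleS iterS -double_scale_split; last exact: admissible_iter.
by rewrite /= odd_double /= -IH.
Qed.

(** The row sums are exact, and the two column deviations are opposite because the total mass is
    1. *)
Lemma sk_error_split p :
  sk_error (u0 R) (v0 R) (split_mx p) = 2 * `|col1 _ p - 7 / 8|.
Proof.
have subE (a b : 'rV[R]_2) j : (a - b) 0 j = a 0 j - b 0 j by rewrite !mxE.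
rewrite /sk_error !norm1_2 !subE.
rewrite !row_sums2 !col_sums2 !split_mxE !u0E !v0E.
rewrite (_ : _ - 5 / 6 = 0); last by ring.
rewrite (_ : _ - 1 / 6 = 0); last by ring.
rewrite (_ : _ - 1 / 8 = - (col1 _ p - 7 / 8)); last by rewrite /col1; field.
by rewrite normr0 normrN /col1; ring.
Qed.

(** The scaled matrix has the support of [A]. Its first column has mass 7/8, more than either row
    can supply alone, so both entries there are positive. *)
Lemma scalable_support A : nonneg_mx A -> uv_scalable (u0 R) (v0 R) A ->
  [/\ 0 < A 0 0, 0 < A 1 0 & 0 < A 0 1 \/ 0 < A 1 1].
Proof.
move=> A0 [x [y [x0 y0 rowE colE]]].
pose B := diag_mx x *m A *m diag_mx y.
have BE i j : B i j = x 0 i * A i j * y 0 j.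
  by rewrite /B mul_mx_diag mxE mul_diag_mx mxE.
have B0 i j : 0 <= B i j by rewrite BE !mulr_ge0 ?A0// ltW.
have AB i j : 0 < B i j -> 0 < A i j.
  by rewrite BE pmulr_lgt0// pmulr_rgt0.
have := row_sums2 B 0; have := row_sums2 B 1.
have := col_sums2 B 0; have := col_sums2 B 1.
rewrite rowE colE !u0E !v0E => c1 c0 r1 r0.
have := B0 0 0; have := B0 0 1; have := B0 1 0; have := B0 1 1.
move=> b11 b10 b01 b00.
split; [apply: AB; lra..|].
by have [b|b] := ltP 0 (B 0 1); [left|right]; apply: AB => //; lra.
Qed.

End TwoByTwo.

(** * Counting the iterations *)

Lemma exp_exceeds (R : realType) (c y : R) : 1 < c -> 1 <= y ->
  exists2 n : nat, y < c ^+ n & n%:R <= ln y / ln c + 1.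
Proof.
move=> c1 y1; have l0 : 0 < ln c by rewrite ln_gt0.
have q0 : 0 <= ln y / ln c by rewrite divr_ge0 ?ln_ge0// ltW.
exists (Num.truncn (ln y / ln c)).+1.
  rewrite -ltr_ln ?posrE ?exprn_gt0; [|lra..].
  rewrite lnXn; last lra.
  by rewrite -mulr_natl -ltr_pdivrMr// truncnS_gt.
by rewrite -addn1 natrD lerD2r; case/andP: (truncn_itv q0).
Qed.

Theorem theorem7p2 (R : realType) :
  exists2 C : R, 0 < C &
    forall (eps : R) (A : 'M[R]_2),
      0 < eps < 1 / 100 ->
      nonneg_mx A ->
      uv_scalable (u0 R) (v0 R) A ->
      exists2 K : nat,
        is_least (fun k => sk_error (u0 R) (v0 R) (sk (u0 R) (v0 R) A k) <= eps) K
        & K%:R <= C * (- ln (nu A) - ln eps).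
Proof.
have rate1 : 1 < rate R by rewrite /rate; lra.
have L0 : 0 < ln (rate R) by rewrite ln_gt0.
(* The count is at most [2 * (n1 + n2)]. Besides [- ln (nu A)], the sum [(n1 + n2) * ln rate] has
   five terms, each at most [- ln eps]: [ln 6], [ln 2], twice [ln rate], and [- ln eps] itself. *)
exists (10 / ln (rate R)); first by rewrite divr_gt0.
move=> eps A /andP[eps0 eps1] A_ge0 /(scalable_support _ _ A_ge0)[a0 c0 bd].
have nu0 := nu_gt0 _ _ _ _ A_ge0 _ _ a0.
have nu1 : nu A <= 1.
  by have := nu_mul_le _ _ _ _ A_ge0 _ _ 0 a0; rewrite -ler_pdivlMr// divff// gt_eqF.
have b_ge0 := A_ge0 0 1; have d_ge0 := A_ge0 1 1.
pose p := (A 0 0 / (A 0 0 + A 0 1), A 1 0 / (A 1 0 + A 1 1)).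
have r0 : 0 < A 0 0 + A 0 1 by lra.
have r1 : 0 < A 1 0 + A 1 1 by lra.
have ap : admissible _ p.
  have xb : 0 < p.1 <= 1 by rewrite divr_gt0//= ler_pdivrMr//; lra.
  have yb : 0 < p.2 <= 1 by rewrite divr_gt0//= ler_pdivrMr//; lra.
  split=> //; move/andP: xb => [_ x1]; move/andP: yb => [_ y1].
  rewrite /col1; case: bd => pos.
    have : p.1 < 1 by rewrite ltr_pdivrMr//; lra.
    lra.
  have : p.2 < 1 by rewrite ltr_pdivrMr//; lra.
  lra.
have nuP w : w = p.1 \/ w = p.2 ->
    (w < 1 -> nu A <= odds _ w) /\ nu A * odds _ w <= 1.
  have row i : 0 < A i 0 -> 0 <= A i 1 -> let w := A i 0 / (A i 0 + A i 1) in
      (w < 1 -> nu A <= odds _ w) /\ nu A * odds _ w <= 1.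
    move=> ai0 ai1 v.
    have -> : odds _ v = A i 1 / A i 0.
      by rewrite /odds /v; field; rewrite !gt_eqF//; lra.
    split; last first.
      by rewrite mulrA ler_pdivrMr// mul1r (nu_mul_le _ _ _ _ A_ge0).
    rewrite /v ltr_pdivrMr; last lra.
    move=> lt; rewrite ler_pdivlMr// (nu_mul_le _ _ _ _ A_ge0)//; lra.
  by case=> ->; apply: row.
(* [n1] contradicts the bound 6 of [band_entry_time], so the band is entered by then. *)
have [n1 n1_gt n1_le] : exists2 n : nat, 6 / nu A < rate R ^+ n &
    n%:R <= ln (6 / nu A) / ln (rate R) + 1.
  by apply: exp_exceeds => //; rewrite ler_pdivlMr//; lra.
(* The error is twice the distance of [col1] to 7/8, which is at most 1 on entering the band; hence
   [2 / eps]. *)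
have [n2 n2_gt n2_le] : exists2 n : nat, 2 / eps < rate R ^+ n &
    n%:R <= ln (2 / eps) / ln (rate R) + 1.
  by apply: exp_exceeds => //; rewrite ler_pdivlMr//; lra.
have [j jn bj] : exists2 j, (j <= n1)%N & in_band _ (iter j (sk_step _) p).
  have [[j jn]|none] := pselect (exists2 j, (j <= n1)%N & in_band _ (iter j (sk_step _) p)).
    by exists j.
  have : nu A * rate R ^+ n1 <= 6.
    by apply: (band_entry_time _ _ _ _ ap) => // j jn bj; apply: none; exists j.
  by rewrite leNgt mulrC -ltr_pdivrMr// n1_gt.
pose P k := sk_error (u0 R) (v0 R) (sk (u0 R) (v0 R) A k) <= eps.
(* [j] steps reach the band and [n2] more shrink the error; each is a column and a row scaling,
   hence the doubling. *)
have PN : P (n2 + j).*2.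
  rewrite /P (sk_double _ _ p)//; last exact: row_scale_split.
  rewrite sk_error_split iterD.
  have aj := admissible_iter _ j _ ap.
  have := in_band_iter _ n2 _ aj bj; set q := iter n2 _ _ => le1.
  have le2 : `|col1 _ (iter j (sk_step R) p) - 7 / 8| <= 1.
    by move: bj => /andP[? ?]; rewrite ler_norml; lra.
  have le3 : 2 / eps * `|col1 _ q - 7 / 8| <= 1.
    apply: le_trans (le_trans le1 le2).
    by rewrite ler_wpM2r// ltW.
  by rewrite -(@ler_pM2l _ eps^-1) ?invr_gt0// mulVf ?gt_eqF// mulrA [_^-1 * _]mulrC.
have exP : exists k, P k by exists (n2 + j).*2.
exists (ex_minn exP); first by case: ex_minnP => k Pk kmin; split.
have Kle : (ex_minn exP <= (n2 + j).*2)%N by case: ex_minnP => k _; apply.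
apply: (@le_trans _ _ ((n2 + n1).*2%:R)).
  by rewrite ler_nat (leq_trans Kle)// leq_double leq_add2l.
(* As [eps < 1 / 100], additive constants are absorbed into [- ln eps]. *)
have ln_eps c : 1 <= c -> c <= 100 -> ln c <= - ln eps.
  move=> c1 c100; rewrite -lnV// ler_ln ?posrE ?invr_gt0//; last lra.
  by apply: le_trans c100 _; rewrite -div1r ler_pdivlMr//; lra.
have l6 := ln_eps 6 ltac:(lra) ltac:(lra).
have l2 := ln_eps 2 ltac:(lra) ltac:(lra).
have lr : ln (rate R) <= - ln eps by apply: ln_eps; rewrite /rate; lra.
have lnu : ln (nu A) <= 0 by rewrite ln_le0.
rewrite (@ln_div _ 6 (nu A)) ?posrE// in n1_le.
rewrite (@ln_div _ 2 eps) ?posrE// in n2_le.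
rewrite -muln2 natrM natrD.
rewrite mulrAC ler_pdivlMr//.
have H1 : n1%:R * ln (rate R) <= ln 6 - ln (nu A) + ln (rate R).
  by rewrite -ler_pdivlMr// mulrDl divff ?gt_eqF.
have H2 : n2%:R * ln (rate R) <= ln 2 - ln eps + ln (rate R).
  by rewrite -ler_pdivlMr// mulrDl divff ?gt_eqF.
lra.
Qed.
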